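(* Fix $\mu_0\in\mathcal P(\mathcal M_0)$ and $\mu_K\in\mathcal P(\mathcal M_K)$ and let $$M:=\inf\Big\{\int_\Omega c\,d\pi:\ \mu_k\in\mathcal P(\widehat{\mathcal M}_k)\ (1\le k\le K-1),\ \pi\in\Pi(\mu_0,\mu_1,\dots,\mu_{K-1},\mu_K)\Big\}.$$ If $M$ is finite and $c$ is coercive, then this optimization problem has a minimizer $\{\pi^*,\{\mu_k^*\}_{k=1}^{K-1}\}$, i.e. there are $\mu_k^*\in\mathcal P(\widehat{\mathcal M}_k)$ and $\pi^*\in\Pi(\mu_0,\mu_1^*,\dots,\mu_{K-1}^*,\mu_K)$ with $\int_\Omega c\,d\pi^*=M$.
   Context: Let $K\ge1$. $(\mathcal M_0,g_0)$ and $(\mathcal M_K,g_K)$ are complete boundaryless smooth Riemannian manifolds and $\mathcal M_k$, $1\le k\le K-1$, are complete smooth Riemannian manifolds. For $1\le k\le K-1$ let $\widehat{\mathcal M}_k:=\mathcal M_k\cup\{\partial_k\}$ with $\partial_k$ an added isolated point; put $\widehat{\mathcal M}_0:=\mathcal M_0$, $\widehat{\mathcal M}_K:=\mathcal M_K$. $\mathcal P(\cdot)$ denotes Borel probability measures. $\Omega:=\prod_{k=0}^K\widehat{\mathcal M}_k$ has the product topology, with projections $T_k$; $\Pi(\mu_0,\dots,\mu_K)$ is the set of $\pi\in\mathcal P(\Omega)$ with $(T_k)_\#\pi=\mu_k$ for all $k$. For $\omega=(\widehat x_0,\dots,\widehat x_K)\in\Omega$, the active indices are $0=k_0<k_1<\dots<k_{n-1}=K$,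 where $\{k_1,\dots,k_{n-2}\}=\{1\le k\le K-1:\widehat x_k\in\mathcal M_k\}$. Given lower semicontinuous $c_{i,j}:\mathcal M_i\times\mathcal M_j\to[0,+\infty]$, $0\le i<j\le K$, the path cost is $c(\omega):=\sum_{l=0}^{n-2}c_{k_l,k_{l+1}}(\widehat x_{k_l},\widehat x_{k_{l+1}})$. A minimizing sequence is a sequence $(\pi_n)$ in $\mathcal P(\Omega)$ with $(T_0)_\#\pi_n=\mu_0$, $(T_K)_\#\pi_n=\mu_K$ and $\int_\Omega c\,d\pi_n\to M$. The cost $c$ is coercive if there is a measurable $\Phi:\Omega\to[0,+\infty]$ such that (1) for every $R>0$ the set $\{\Phi\le R\}$ is compact; and (2) there exists a minimizing sequence $(\pi_n)$ with $\sup_n\int_\Omega\Phi\,d\pi_n<\infty$. *)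

(* Defs.v *)
From HB Require Import structures.
From mathcomp Require Import all_boot all_order all_algebra.
From mathcomp Require Import all_classical all_reals all_analysis.
From mathcomp Require Import measurable_realfun.

Set Implicit Arguments.
Unset Strict Implicit.
Unset Printing Implicit Defensive.

Import Order.TTheory GRing.Theory Num.Theory.
Import numFieldNormedType.Exports.

Local Open Scope classical_set_scope.
Local Open Scope ring_scope.

Section smooth.
Context {R : realType} {V W : normedModType R}.

Fixpoint Ck (k : nat) (U : set V) (f : V -> W) : Prop :=
  if k is k'.+1 then
    (forall x, U x -> differentiable f x) /\ (forall v, Ck k' U ('D_v f))
  else forall x, U x -> {for x, continuous f}.

(* [A] need not be open (images of boundary charts are not): [h] is a smooth
   function on a neighborhood of [x] that coincides with [f] on [A] there. *)
Definition smooth_extension (A : set V) (f : V -> W) (x : V) (h : V -> W) :=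
  exists U : set V, [/\ open U, U x, forall k, Ck k U h &
    forall y, U y -> A y -> h y = f y].

Definition smooth_on (A : set V) (f : V -> W) :=
  forall x, A x -> exists h, smooth_extension A f x h.

End smooth.

(* For [n = 0] this is the whole space ['rV_0]. *)
Definition half_space (R : realType) (n : nat) : set 'rV[R]_n :=
  [set x | forall j : 'I_n, j = 0%N :> nat -> 0 <= x 0 j].

Definition bilin (R : realType) (n : nat) (G : 'M[R]_n) (v w : 'rV[R]_n) : R :=
  (v *m G *m w^T) 0 0.

(* A smooth atlas on [M], together with the matrix [metric i] of the metric
   tensor in each chart [i].  The values of [coord i] outside [dom i], and those
   of [param i] and [metric i] outside the image of the chart, are irrelevant. *)
Record riemannian (R : realType) (n : nat) (M : topologicalType) := Riemannian {
  chart : Type;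
  dom : chart -> set M;
  coord : chart -> M -> 'rV[R]_n;
  param : chart -> 'rV[R]_n -> M;
  metric : chart -> 'rV[R]_n -> 'M[R]_n;
  manifold_hausdorff : hausdorff_space M;
  manifold_second_countable : @second_countable M;
  dom_open : forall i, open (dom i);
  dom_cover : forall p, exists i, dom i p;
  coordK : forall i p, dom i p -> param i (coord i p) = p;
  coord_continuous : forall i, {within dom i, continuous (coord i)};
  param_continuous : forall i,
    {within coord i @` dom i, continuous (param i)};
  (* a chart takes values in R^n or, near the boundary, in the half-space *)
  image_open : forall i, open (coord i @` dom i) \/
    exists2 U, open U & coord i @` dom i = U `&` @half_space R n;
  transition_smooth : forall i j,
    smooth_on (coord i @` (dom i `&` dom j)) (coord j \o param i);
  metric_sym : forall i x, (coord i @` dom i) x ->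
    (metric i x)^T = metric i x;
  metric_pos : forall i x v, (coord i @` dom i) x -> v != 0 ->
    0 < bilin (metric i x) v v;
  metric_smooth : forall i, smooth_on (coord i @` dom i) (metric i);
  (* the transition map is differentiated through a smooth extension; the result
     does not depend on it, [x] being in the closure of the interior of the
     image *)
  metric_change : forall i j x h,
    (coord i @` (dom i `&` dom j)) x ->
    smooth_extension (coord i @` (dom i `&` dom j)) (coord j \o param i) x h ->
    forall v w,
      bilin (metric i x) v w = bilin (metric j (h x)) ('D_v h x) ('D_w h x)
}.

Section riemannian_distance.
Context {R : realType} {n : nat} {M : topologicalType}.
Variable g : riemannian R n M.

(* By invariance of domain, a point is a boundary point in one chart iff it is
   in all of them. *)
Definition boundaryless := forall i : chart g, open (coord i @` dom i).

(* a C^1 curve in coordinates, running in chart [i] for times in [0, 1] *)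
Definition chart_curve (i : chart g) (u : R^o -> 'rV[R]_n) :=
  Ck 1 setT u /\ forall t : R, 0 <= t <= 1 -> (coord i @` dom i) (u t).

Definition curve_length (i : chart g) (u : R^o -> 'rV[R]_n) : R :=
  (\int[lebesgue_measure]_(t in `[0%R, 1%R])
    Num.sqrt (bilin (metric i (u t)) ('D_1 u t) ('D_1 u t)))%R.

(* [has_path p q l]: a piecewise C^1 curve of length [l] runs from [p] to [q].
   Every such curve splits into finitely many pieces contained in one chart. *)
Inductive has_path : M -> M -> R -> Prop :=
| has_path_nil p : has_path p p 0
| has_path_cons i u q l : chart_curve i u ->
    has_path (param i (u 1)) q l ->
    has_path (param i (u 0)) q (curve_length i u + l).

(* [+oo] if [p] and [q] are in different components *)
Definition geodesic_dist (p q : M) : \bar R :=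
  ereal_inf [set l%:E | l in has_path p q].

Definition metrically_complete :=
  forall s : nat -> M,
    (forall e : R, 0 < e -> exists N : nat, forall i j : nat,
      (N <= i)%N -> (N <= j)%N -> (geodesic_dist (s i) (s j) < e%:E)%E) ->
    exists p : M, s @ \oo --> p.

End riemannian_distance.

(* [None] is the added point, and [Some] an open embedding *)
Definition adjoin_point (X : Type) : Type := option X.

Section adjoin_point_topology.
Context {X : topologicalType}.

HB.instance Definition _ := Choice.on (adjoin_point X).
HB.instance Definition _ := Pointed.on (adjoin_point X).

Definition adjoin_open : set_system (adjoin_point X) :=
  [set U | open (Some @^-1` U)].

Let adjoin_openT : adjoin_open setT.
Proof. exact: openT. Qed.

Let adjoin_openI : setI_closed adjoin_open.
Proof. by move=> A B oA oB; exact: openI. Qed.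

Let adjoin_open_bigcup (I : Type) (f : I -> set (adjoin_point X)) :
  (forall i, adjoin_open (f i)) -> adjoin_open (\bigcup_i f i).
Proof.
move=> fo; rewrite /adjoin_open/= preimage_bigcup.
by apply: bigcup_open => i _; exact: fo.
Qed.

HB.instance Definition _ := isOpenTopological.Build (adjoin_point X)
  adjoin_openT adjoin_openI adjoin_open_bigcup.

End adjoin_point_topology.

Definition hat (b : bool) (X : ptopologicalType) : ptopologicalType :=
  if b return ptopologicalType then adjoin_point X else X.

(* [None] for the added point *)
Definition visible (b : bool) (X : ptopologicalType) : hat b X -> option X :=
  match b with true => id | false => Some end.

Notation borel T := (g_sigma_algebraType (@open T)).

Section problem.
Context {R : realType} {K : nat} {M : 'I_K.+1 -> ptopologicalType}.

Definition hat_at (k : 'I_K.+1) : ptopologicalType :=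
  hat (0 < k < K)%N (M k).

Definition Omega : Type := prod_topology (fun k => hat_at k).

HB.instance Definition _ := Topological.on Omega.
HB.instance Definition _ := isPointed.Build Omega (fun k => point).

Definition T_ (k : 'I_K.+1) (w : borel Omega) : borel (hat_at k) := w k.

Definition active_points (w : Omega) : seq {k : 'I_K.+1 & M k} :=
  pmap (fun k => omap (existT _ k) (visible (w k))) (enum 'I_K.+1).

Variable c : forall i j : 'I_K.+1, M i -> M j -> \bar R.

Fixpoint chain_cost (s : seq {k : 'I_K.+1 & M k}) : \bar R :=
  match s with
  | x :: (y :: _) as s' => (c (tagged x) (tagged y) + chain_cost s')%E
  | _ => 0%E
  end.

Definition path_cost (w : Omega) : \bar R := chain_cost (active_points w).

Definition cost (pi : probability (borel Omega) R) : \bar R :=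
  (\int[pi]_w path_cost w)%E.

(* Measures are total functions, unconstrained on non-measurable sets. *)
Definition eq_on_borel (T : ptopologicalType) (mu nu : set (borel T) -> \bar R) :=
  forall A, measurable A -> mu A = nu A.

Definition marginal (k : 'I_K.+1) (pi : probability (borel Omega) R)
    (nu : probability (borel (hat_at k)) R) :=
  eq_on_borel (pushforward pi (T_ k)) nu.

Definition Pi (mu : forall k, probability (borel (hat_at k)) R)
    (pi : probability (borel Omega) R) :=
  forall k, marginal pi (mu k).

Variables (mu0 : probability (borel (hat_at ord0)) R)
          (muK : probability (borel (hat_at ord_max)) R).

Definition feasible (mu : forall k, probability (borel (hat_at k)) R)
    (pi : probability (borel Omega) R) :=
  [/\ eq_on_borel (mu ord0) mu0, eq_on_borel (mu ord_max) muK & Pi mu pi].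

Definition optimal_value : \bar R :=
  ereal_inf [set v | exists mu pi, feasible mu pi /\ v = cost pi].

Definition minimizing_sequence (pi : nat -> probability (borel Omega) R) :=
  [/\ forall n, marginal (pi n) mu0, forall n, marginal (pi n) muK &
    (fun n => cost (pi n)) @ \oo --> optimal_value].

Definition coercive := exists Phi : borel Omega -> \bar R,
  [/\ measurable_fun setT Phi,
      forall w, (0 <= Phi w)%E,
      forall r : R, 0 < r -> compact ([set w | (Phi w <= r%:E)%E] : set Omega) &
      exists pi, minimizing_sequence pi /\
        (ereal_sup (range (fun n => \int[pi n]_w Phi w)) < +oo)%E].

End problem.

(* Main.v *)
Require Import Defs.
From HB Require Import structures.
From mathcomp Require Import all_boot all_order all_algebra.
From mathcomp Require Import all_classical all_reals all_analysis.
From mathcomp Require Import measurable_realfun lra.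

Set Implicit Arguments.
Unset Strict Implicit.
Unset Printing Implicit Defensive.

Import Order.TTheory GRing.Theory Num.Theory.
Import numFieldNormedType.Exports.

Local Open Scope classical_set_scope.
Local Open Scope ring_scope.

(** Tightness provides a minimizer by Prokhorov's argument, run directly on the
    Hausdorff space Omega.  Along an ultrafilter [U] on the integers finer than
    the cofinite filter, [lam A = lim_U (P n A)] is a finitely additive
    probability; the set function [O |-> sup {lam C | C compact, C `<=` O}] on
    open sets extends to a Borel measure [mu], which has total mass 1 by
    tightness and satisfies [mu O <= lam O] for every open [O].  This inequality
    is enough to conclude: it gives [int f dmu <= lim int f d(P n)] for every
    nonnegative lower semicontinuous [f], in particular for the path cost, and
    it forces [mu] to have the prescribed marginals, because an inequality on
    open sets between two probabilities, one of them tight, on a second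
    countable Hausdorff space is an equality. *)

(** * Compact sets in Hausdorff spaces *)

(** If [P C] failed, the sets [A] with [P (C \ A)] would form a proper filter containing [C]. At a
    cluster point, the local hypothesis puts the complement of a neighborhood into this filter,
    which is absurd. *)
Lemma compact_induction (T : topologicalType) (C : set T) (P : set T -> Prop) :
  compact C -> P set0 ->
  (forall A B, A `<=` B -> P B -> P A) ->
  (forall A B, P A -> P B -> P (A `|` B)) ->
  (forall x, C x -> exists2 U, nbhs x U & P (U `&` C)) ->
  P C.
Proof.
move=> cC P0 Psub PU Ploc; apply: contrapT => nPC.
pose F : set_system T := [set A | P (C `\` A)].
have FF : ProperFilter F.
  split; first by rewrite /F/= setD0.
  split; rewrite /F/=.
  - by rewrite setDT.
  - by move=> A B PA PB; rewrite /= setDE setCI setIUr -!setDE; exact: PU.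
  - by move=> A B AB; apply: Psub; exact: setDS.
have FC : F C by rewrite /F/= setDv.
have [x [Cx clx]] := cC F FF FC.
have [U xU PUC] := Ploc x Cx.
have [] : ~` U `&` U !=set0.
  by apply: clx => //; rewrite /F/= setDE setCK setIC.
by move=> y [].
Qed.

(** Compact induction on [C \ O]: the Hausdorff property separates [x] from each point of this set,
    and finitely many neighborhoods of [x] are intersected. *)
Lemma compact_separate_closure (T : topologicalType) (C O : set T) (x : T) :
  hausdorff_space T -> compact C -> open O -> O x ->
  exists2 U, open U /\ U x & closure U `&` C `<=` O.
Proof.
move=> hT cC oO Ox.
pose P A := exists2 U, open U /\ U x & closure U `&` A = set0.
have [U [oU Ux] UCO] : P (C `\` O); last first.
  exists U => // y [Uy Cy]; apply: contrapT => Oy.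
  by have : set0 y by rewrite -UCO.
apply: compact_induction.
- by apply: (subclosed_compact _ cC) => //; apply: closedI;
    [exact: compact_closed|exact: open_closedC].
- by exists setT; [split => //; exact: openT|rewrite setI0].
- move=> A B AB [U Ux UB]; exists U => //; apply/seteqP; split => // y [Uy Ay].
  by rewrite -UB; split => //; exact: AB.
- move=> A B [U [oU Ux] UA] [V [oV Vx] VB]; exists (U `&` V).
    by split; [exact: openI|].
  apply/seteqP; split => // y [UVy [Ay|By]].
    by rewrite -UA; split => //; apply: closureS UVy; exact: subIsetl.
  by rewrite -VB; split => //; apply: closureS UVy; exact: subIsetr.
- move=> y [Cy Oy]; have xy : x != y by apply: contra_notN Oy => /eqP <-.
  move: (hT); rewrite open_hausdorff => /(_ x y xy)[[A B]]/=.
  rewrite !inE => -[Ax By] [oA oB AB0]; exists B.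
    exact: open_nbhs_nbhs.
  exists A => //; apply/seteqP; split => // z [clz [Bz _]].
  have [t ABt] : A `&` B !=set0 by apply: clz; exact: open_nbhs_nbhs.
  by have : set0 t by rewrite -AB0.
Qed.

(** Turns a countable open cover into finitely many compact pieces, to which finite subadditivity of
    a content applies. *)
Lemma compact_shrink_cover (T : topologicalType) (C : set T) (O : (set T)^nat) :
  hausdorff_space T -> compact C -> (forall n, open (O n)) ->
  C `<=` \bigcup_n O n ->
  exists N, exists2 D : (set T)^nat, (forall n, compact (D n) /\ D n `<=` O n) &
    C `<=` \bigcup_(n < N) D n.
Proof.
move=> hT cC oO CO.
apply: (compact_induction (P := fun A => exists N, exists2 D : (set T)^nat,
   (forall n, compact (D n) /\ D n `<=` O n) &
    A `<=` \bigcup_(n < N) D n)) => //.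
- exists 0%N, (fun=> set0); last by [].
  by move=> n; split; [exact: compact0|exact: sub0set].
- move=> A B AB [N [D DO BD]]; exists N, D; [exact: DO|exact: subset_trans AB BD].
- move=> A B [N [D DO AD]] [N' [D' DO' BD']].
  exists (maxn N N'), (fun n => D n `|` D' n).
    move=> n; have [cD sD] := DO n; have [cD' sD'] := DO' n.
    by split; [exact: compactU|rewrite subUset].
  move=> x [/AD|/BD'] [i/= iN Dx]; exists i => /=.
  + by rewrite (leq_trans iN)// leq_maxl.
  + by left.
  + by rewrite (leq_trans iN)// leq_maxr.
  + by right.
- move=> x Cx; have [n _ Onx] := CO x Cx.
  have [U [oU Ux] UCO] := compact_separate_closure hT cC (oO n) Onx.
  exists U; first exact: open_nbhs_nbhs.
  exists n.+1, (fun i => if i == n then closure U `&` C else set0).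
    move=> i; case: eqP => [->|_]; split => //; last exact: compact0.
    rewrite setIC; apply: compact_closedI => //; exact: closed_closure.
  move=> y [Uy Cy]; exists n; rewrite /= ?ltnS// eqxx.
  by split => //; exact: subset_closure.
Qed.

Lemma compact_borel (T : ptopologicalType) (C : set T) :
  hausdorff_space T -> compact C -> measurable (C : set (borel T)).
Proof.
move=> hT cC; rewrite -[C]setCK; apply: measurableC.
by apply: sub_sigma_algebra; apply: closed_openC; exact: compact_closed.
Qed.

(** * Extension of an inner content to a Borel measure *)

Section inner_regular_extension.
Local Open Scope ereal_scope.
Context {R : realType} {T : ptopologicalType}.
Hypothesis hT : hausdorff_space T.
Variable lam : {content set (borel T) -> \bar R}.
Hypothesis lam_fin : fin_num_fun lam.

Definition inner_content (A : set T) : \bar R :=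
  ereal_sup [set lam C | C in [set C : set T | compact C /\ C `<=` A]].

Let inner0 : inner_content set0 = 0.
Proof.
rewrite /inner_content (_ : image _ _ = [set 0]) ?ereal_sup1//.
apply/seteqP; split => [_ [C [_ +] <-]|_ ->]/=.
  by rewrite subset0 => ->; exact: measure0.
by exists set0; rewrite ?measure0//; split => //; exact: compact0.
Qed.

Let inner_ge (C A : set T) : compact C -> C `<=` A -> lam C <= inner_content A.
Proof. by move=> cC CA; apply: ereal_sup_ubound; exists C. Qed.

Let inner_ge0 A : 0 <= inner_content A.
Proof. by rewrite -(measure0 lam); apply: inner_ge => //; exact: compact0. Qed.

Let inner_subadd (A : set T) (O : (set T)^nat) : (forall n, open (O n)) ->
  A `<=` \bigcup_n O n -> inner_content A <= \sum_(n <oo) inner_content (O n).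
Proof.
move=> oO AO; apply: ge_ereal_sup => _ [C [cC CA] <-].
have [N [D DO CD]] := compact_shrink_cover hT cC oO (subset_trans CA AO).
apply: (@le_trans _ _ (\sum_(n < N) lam (D n))).
  apply: content_subadditive => //.
  - by move=> k _; apply: compact_borel => //; have [] := DO k.
  - exact: compact_borel.
  - by rewrite -bigcup_mkord.
apply: (@le_trans _ _ (\sum_(n < N) inner_content (O n))).
  by apply: lee_sum => i _; have [] := DO i => ? ?; exact: inner_ge.
rewrite -(big_mkord xpredT (fun n => inner_content (O n))).
exact: nneseries_lim_ge.
Qed.

(** A compact [D] inside [G \ C] is disjoint from [C], so [C U D] competes in the supremum for [G].
    Finiteness of [lam C] allows the subtraction. *)
Let inner_disj (C G : set T) : compact C -> C `<=` G ->
  lam C + inner_content (G `\` C) <= inner_content G.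
Proof.
move=> cC CG; have fC : lam C \is a fin_num by apply: lam_fin; exact: compact_borel.
rewrite -leeBrDl//; apply: ge_ereal_sup => _ [D [cD DGC] <-].
rewrite leeBrDl// -measureU//; [|exact: compact_borel..|].
- apply: inner_ge; first exact: compactU.
  by rewrite subUset; split => // x /DGC[].
- by apply/seteqP; split => // x [Cx /DGC[]].
Qed.

(** The value [+oo] off the open sets turns [mu_ext], an infimum over Borel covers, into an infimum
    over open covers. *)
Let opencont (A : set (borel T)) : \bar R :=
  if `[< open (A : set T) >] then inner_content A else +oo.

Let opencontE (A : set T) : open A -> opencont A = inner_content A.
Proof. by move=> oA; rewrite /opencont; case: asboolP. Qed.

Let opencont0 : opencont set0 = 0.
Proof. by rewrite opencontE ?inner0//; exact: open0. Qed.

Let opencont_ge0 A : 0 <= opencont A.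
Proof. by rewrite /opencont; case: ifP. Qed.

Let ext : set T -> \bar R := @mu_ext _ (borel T) R opencont.

Let ext_le (A G : set T) : open G -> A `<=` G -> ext A <= inner_content G.
Proof.
move=> oG AG; apply: ereal_inf_lbound.
exists (fun n => if n is 0%N then G : set (borel T) else set0).
  by split=> [[|n]|x /AG Gx]; [exact: sub_sigma_algebra|exact: measurable0|exists 0%N].
rewrite nneseries_recl// eseries0 ?adde0 ?opencontE// => -[|n]//.
Qed.

(** A cover with a non-open term has infinite sum; an open cover can be replaced by its union, by
    [inner_subadd]. With [ext_le], this makes [ext] the infimum of [inner_content] over open
    supersets. *)
Let ext_ge (A : set T) (y : \bar R) :
  (forall G, open G -> A `<=` G -> y <= inner_content G) -> y <= ext A.
Proof.
move=> yG; apply: le_ereal_inf_tmp => _ [F [mF AF] <-].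
have [oF|/existsNP[n nF]] := pselect (forall n, open (F n : set T)); last first.
  rewrite (@eseries_pinfty _ _ _ n) ?leey//.
  - by move=> k _; rewrite gt_eqF// (lt_le_trans _ (opencont_ge0 _)).
  - by rewrite /opencont; case: asboolP.
have oG : open (\bigcup_n F n : set T) by exact: bigcup_open.
apply: (le_trans (yG _ oG AF)).
rewrite (eq_eseriesr (fun n _ => opencontE (oF n))).
exact: inner_subadd.
Qed.

Let ext_open (A : set T) : open A -> ext A = inner_content A.
Proof.
move=> oA; apply/eqP; rewrite eq_le ext_le//=; apply: ext_ge => G oG AG.
apply: ge_ereal_sup => _ [C [cC CA] <-]; apply: inner_ge => //.
exact: subset_trans AG.
Qed.

Let ext_ge0 A : 0 <= ext A.
Proof. exact: mu_ext_ge0. Qed.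

Let ext_caratheodory (O : set T) : open O -> ext.-caratheodory O.
Proof.
pose om : {outer_measure set T -> \bar R} :=
  HB.pack ext (isOuterMeasure.Build R T ext
  (@mu_ext0 _ (borel T) R opencont opencont0 opencont_ge0)
  (mu_ext_ge0 opencont_ge0) (le_mu_ext opencont)
  (mu_ext_sigma_subadditive opencont_ge0)).
move=> oO; apply: (@le_caratheodory_measurable _ _ om) => X.
apply: ext_ge => G oG XG.
have fE : ext (X `&` ~` O) <= inner_content G by apply: ext_le => // x [/XG].
have [Goo|Gfin] := eqVneq (inner_content G) +oo; first by rewrite Goo leey.
have Efin : ext (X `&` ~` O) \is a fin_num.
  by rewrite ge0_fin_numE ?ext_ge0// (le_lt_trans fE)// ltey.
rewrite -leeBrDr//; apply: (@le_trans _ _ (inner_content (G `&` O))).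
  by apply: ext_le; [exact: openI|exact: setSI].
(* A compact [C] inside [G] and [O] is closed, so [G \ C] is an open superset of [X \ O], and
   [inner_disj] applies to [C] and [G]. *)
apply: ge_ereal_sup => _ [C [cC CGO] <-]; rewrite leeBrDr//.
apply: (le_trans _ (inner_disj cC (subset_trans CGO (@subIsetl _ _ _)))).
apply: leeD => //; apply: ext_le.
  by rewrite setDE; apply: openI => //; apply: closed_openC; exact: compact_closed.
by move=> x [/XG Gx Ox]; split => // /CGO[].
Qed.

Lemma inner_content_measure : exists mu : {measure set (borel T) -> \bar R},
  forall O : set T, open O -> mu O = inner_content O.
Proof.
pose om : {outer_measure set T -> \bar R} :=
  HB.pack ext (isOuterMeasure.Build R T ext
  (@mu_ext0 _ (borel T) R opencont opencont0 opencont_ge0)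
  (mu_ext_ge0 opencont_ge0) (le_mu_ext opencont)
  (mu_ext_sigma_subadditive opencont_ge0)).
have sub (A : set (borel T)) : measurable A ->
    measurable (A : set (caratheodory_type om)).
  apply: smallest_sub; first exact: sigma_algebra_measurable.
  by move=> O oO; exact: ext_caratheodory.
have sadd : semi_sigma_additive (ext : set (borel T) -> \bar R).
  move=> F mF tF mUF; apply: (@caratheodory_measure_sigma_additive _ _ om) => //.
  - by move=> i; exact: sub.
  - exact: sub.
pose mu : {measure set (borel T) -> \bar R} :=
  HB.pack (ext : set (borel T) -> \bar R)
    (isMeasure.Build _ _ _ (ext : set (borel T) -> \bar R)
      (@mu_ext0 _ (borel T) R opencont opencont0 opencont_ge0)
      (mu_ext_ge0 opencont_ge0) sadd).
by exists mu; exact: ext_open.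
Qed.

End inner_regular_extension.

(** * Ultralimits of tight sequences *)

Lemma ultra_compact_cvg (I : Type) (U : set_system I) (T : topologicalType)
    (f : I -> T) (C : set T) :
  UltraFilter U -> compact C -> U (f @^-1` C) -> exists2 p, C p & f @ U --> p.
Proof.
move=> UU cC UC; have [p [Cp clp]] := cC (f @ U) _ UC.
exists p => // V pV; have [//|UnV] := in_ultra_setVsetC (f @^-1` V) UU.
by have [|y []] := clp (~` V) V _ pV.
Qed.

Section ultralimit.
Local Open Scope ereal_scope.
Context d (T : measurableType d) (R : realType) (U : set_system nat).
Hypothesis UU : UltraFilter U.
Variable P : nat -> probability T R.

Let ultralimit_cvg (A : set T) : measurable A ->
  exists2 l : R, (0 <= l <= 1)%R & P n A @[n --> U] --> l%:E.
Proof.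
move=> mA; have [||l] := @ultra_compact_cvg _ U _ (fun n => fine (P n A))
    `[0%R, 1%R]%classic UU.
- exact: segment_compact.
- apply: filterE => n /=; rewrite in_itv/= fine_ge0//=.
  by rewrite -lee_fin fineK ?fin_num_measure// probability_le1.
- rewrite /= in_itv/= => l01 fl; exists l => //.
  apply/fine_cvgP; split => //.
  by apply: nearW => n; rewrite fin_num_measure.
Qed.

(** Limits along [U] commute with finite sums but may lose countable additivity, so only a content
    results. *)
Lemma ultralimit_content : exists2 lam : {content set T -> \bar R},
  fin_num_fun lam & forall A, measurable A -> P n A @[n --> U] --> lam A.
Proof.
(* A content is nonnegative on all sets, hence a value 0 is supplied off the measurable ones. *)
have /choice[l lP] : forall A : set T, exists l : R, (0 <= l)%R /\
    (measurable A -> P n A @[n --> U] --> l%:E).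
  move=> A; have [mA|nA] := pselect (measurable A); last by exists 0%R; split.
  by have [l /andP[l0 _] Pl] := ultralimit_cvg mA; exists l.
pose lam A := (l A)%:E.
have lam0 A : 0 <= lam A by rewrite lee_fin; have [] := lP A.
have lamP A : measurable A -> P n A @[n --> U] --> lam A by have [] := lP A.
have ladd : measure_function.semi_additive lam.
  move=> F n mF tF mUF; have /cvg_unique := lamP _ mUF; apply => //.
  rewrite (_ : (fun k => P k _) = (fun k => \sum_(i < n) P k (F i))).
    by apply: cvg_nnesum => j _; [exact: nearW|exact: lamP].
  by apply/funext => k; rewrite measure_semi_additive.
pose lamC : {content set T -> \bar R} :=
  HB.pack lam (isContent.Build _ _ _ lam lam0 ladd).
by exists lamC.
Qed.

End ultralimit.

(* one half of the portmanteau theorem, taken as the definition of a limit *)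
Definition open_limit (R : realType) (T : ptopologicalType) (U : set_system nat)
    (P : nat -> probability (borel T) R) (mu : probability (borel T) R) :=
  forall O : set T, open O ->
    exists2 l : \bar R, P n O @[n --> U] --> l & (mu O <= l)%E.

Lemma open_limit_exists (R : realType) (T : ptopologicalType)
    (U : set_system nat) (P : nat -> probability (borel T) R) :
  hausdorff_space T -> UltraFilter U ->
  (forall e : R, 0 < e -> exists2 C : set T, compact C &
    forall n, ((1 - e)%:E <= P n C)%E) ->
  exists mu : probability (borel T) R, open_limit U P mu.
Proof.
move=> hT UU tight.
have [lam lamfin lamP] := ultralimit_content UU P.
have [mu muE] := inner_content_measure hT lamfin.
have mO (O : set T) : open O -> measurable (O : set (borel T)).
  exact: sub_sigma_algebra.
have mule (O : set T) : open O -> (mu O <= lam O)%E.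
  move=> oO; rewrite muE//; apply: ge_ereal_sup => _ [C [cC CO] <-].
  by rewrite le_measure ?inE//; [exact: compact_borel|exact: mO].
have lam1 : lam setT = 1%E.
  have /cvg_unique := lamP _ measurableT; apply => //.
  rewrite (_ : (fun n => _) = cst 1%E); first exact: cvg_cst.
  by apply/funext => n; rewrite probability_setT.
have mu1 : mu setT = 1%E.
  apply/eqP; rewrite eq_le -{1}lam1 mule/=; last exact: openT.
  apply/lee_subgt0Pr => e e0; have [C cC CP] := tight e e0.
  rewrite muE; last exact: openT.
  apply: (@le_trans _ _ (lam C)); last by apply: ereal_sup_ubound; exists C.
  by apply: (cvge_to_ge (lamP _ (compact_borel hT cC))); exact: nearW.
(* As [mu] has mass 1, [mnormalize] gives [mu] back, packaged as a probability; [P 0%N] is its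
   default for mass 0 or [+oo]. *)
exists (mnormalize mu (P 0%N)) => O oO.
rewrite /= /mnormalize mu1 onee_eq0/= invr1 mule1.
exists (lam O); first by apply: lamP; exact: mO.
exact: (mule O oO).
Qed.

(** * Integrals of lower semicontinuous functions *)

Section staircase.
Context {R : realType}.
Implicit Types (e : R) (N : nat) (y : \bar R).

(** Approximates [y] from below with error at most [e], up to the cap [N * e]. Composed with a lower
    semicontinuous function, it is a finite combination of indicators of open sets. *)
Definition staircase e N y : R :=
  \sum_(j < N) e * ((j.+1%:R * e)%:E < y)%E%:R.

Lemma staircase_real e N (r : R) : 0 < e -> 0 <= r ->
  Num.min (N%:R * e) (r - e) <= staircase e N r%:E <= Num.min (N%:R * e) r.
Proof.
move=> e0 r0; elim: N => [|N IH].
  by rewrite /staircase big_ord0 mul0r le_min ge_min r0 !lexx.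
have : staircase e N.+1 r%:E =
    staircase e N r%:E + e * (N.+1%:R * e < r)%R%:R.
  by rewrite /staircase big_ord_recr/= lte_fin.
move: IH => /andP[]; rewrite !le_min !ge_min => + /andP[].
rewrite -natr1 mulrDl mul1r.
case: ltP => /= h lo h1 h2 ->; rewrite ?mulr1 ?mulr0 ?addr0.
- have {}lo : N%:R * e <= staircase e N r%:E.
    by move/orP : lo => [//|]; lra.
  by apply/andP; split; [apply/orP; left|apply/andP; split]; lra.
- by apply/andP; split; [apply/orP; right; move/orP : lo => []|apply/andP; split]; lra.
Qed.

Lemma staircase_pinfty e N : staircase e N +oo%E = N%:R * e.
Proof.
rewrite /staircase (eq_bigr (fun=> e)) => [|j _]; last by rewrite ltry mulr1.
by rewrite sumr_const card_ord mulr_natl.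
Qed.

Lemma staircase_le e N y : 0 < e -> (0 <= y)%E -> ((staircase e N y)%:E <= y)%E.
Proof.
move=> e0; case: y => [r| |]//; last by move=> _; rewrite leey.
rewrite !lee_fin => r0; have /andP[_] := staircase_real N e0 r0.
by rewrite le_min => /andP[].
Qed.

(** With mesh [1/(n+1)] and [(n+1)^2] levels, the error vanishes while the cap [n+1] tends to
    infinity, which covers [y = +oo] too. *)
Lemma staircase_cvg y : (0 <= y)%E ->
  (staircase n.+1%:R^-1 (n.+1 * n.+1) y)%:E @[n --> \oo] --> y.
Proof.
have E n : (n.+1 * n.+1)%:R * n.+1%:R^-1 = n.+1%:R :> R.
  by rewrite natrM mulfK// pnatr_eq0.
case: y => [r| |]//; last first.
  move=> _; under eq_fun do rewrite staircase_pinfty E.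
  apply/cvgeryP; apply/cvgryPge => A; near=> n.
  rewrite -natr1 (@le_trans _ _ n%:R)// ?lerDl//.
  by near: n; exact: nbhs_infty_ger.
rewrite lee_fin => r0; apply/fine_cvgP; split; first exact: nearW.
apply: (@squeeze_cvgr _ _ _ _ (fun n => r - n.+1%:R^-1) (fun=> r)).
- near=> n.
  have /andP[lo hi] := staircase_real (n.+1 * n.+1)
    (e := n.+1%:R^-1) (r := r) ltac:(by rewrite invr_gt0) r0.
  move: lo hi; rewrite /= E le_min ge_min => lo /andP[_ ->]; rewrite andbT.
  move/orP : lo => [|//]; apply: le_trans.
  rewrite (@le_trans _ _ r)// ?lerBlDr ?lerDl ?invr_ge0//.
  rewrite -natr1 (@le_trans _ _ n%:R)// ?lerDl//.
  by near: n; exact: nbhs_infty_ger.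
- rewrite -[X in _ --> X]subr0; apply: cvgB; first exact: cvg_cst.
  exact: cvg_harmonic.
- exact: cvg_cst.
Unshelve. all: by end_near. Qed.

Lemma integral_staircase d (T : measurableType d) (mu : {measure set T -> \bar R})
    (f : T -> \bar R) e N :
  0 < e -> (forall a : R, measurable [set x | (a%:E < f x)%E]) ->
  (\int[mu]_x (staircase e N (f x))%:E =
   \sum_(j < N) e%:E * mu [set x | ((j.+1%:R * e)%:E < f x)%E])%E.
Proof.
move=> e0 mf.
have E x : (staircase e N (f x))%:E = (\sum_(j < N)
    e%:E * (\1_[set x | ((j.+1%:R * e)%:E < f x)%E] x)%:E)%E.
  rewrite /staircase -sumEFin; apply: eq_bigr => j _.
  rewrite EFinM indicE; congr (_ * (nat_of_bool _)%:R%:E)%E.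
  by apply/idP/idP; rewrite inE.
under eq_integral do rewrite E.
rewrite ge0_integral_sum//.
- apply: eq_bigr => j _; rewrite ge0_integralZl//.
  + by rewrite integral_indic// setIT.
  + exact/measurable_EFinP/measurable_indic.
  + by rewrite lee_fin ltW.
- move=> j; apply: emeasurable_funM => //.
  exact/measurable_EFinP/measurable_indic.
- by move=> j x _; rewrite mule_ge0// lee_fin ltW.
Qed.

End staircase.

Lemma lower_semicontinuous_borel (R : realType) (T : ptopologicalType)
    (f : T -> \bar R) : lower_semicontinuous f ->
  measurable_fun setT (f : borel T -> \bar R).
Proof.
move=> lf; apply: (measurability _ (ErealGenOInfty.measurableE R)).
move=> /= _ [_ [a ->]] <-; apply: measurableI => //.
apply: sub_sigma_algebra; rewrite preimage_itvoy.
by move/lower_semicontinuousP : lf; exact.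
Qed.

(* Integrating superlevel sets over levels turns the inequality on open sets
   into lower semicontinuity of the integral; only finitely many levels are used
   because the limit along [U] need not commute with an infinite sum. *)
Lemma open_limit_integral_le (R : realType) (T : ptopologicalType)
    (U : set_system nat) (P : nat -> probability (borel T) R)
    (mu : probability (borel T) R) (f : T -> \bar R) (m : \bar R) :
  ProperFilter U -> open_limit U P mu ->
  lower_semicontinuous f -> (forall x, 0 <= f x)%E ->
  (\int[P n]_x f x)%E @[n --> U] --> m -> (\int[mu]_x f x <= m)%E.
Proof.
move=> PU muP lf f0 fm.
have oS a : open [set x : T | (a%:E < f x)%E] by move/lower_semicontinuousP: lf; exact.
have mS a : measurable ([set x | (a%:E < f x)%E] : set (borel T)).
  exact: sub_sigma_algebra.
have mf := lower_semicontinuous_borel lf.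
pose g n x := (staircase n.+1%:R^-1 (n.+1 * n.+1) (f x))%:E.
have n0 n : 0 < n.+1%:R^-1 :> R by rewrite invr_gt0.
have stair0 n x : (0 <= g n x)%E.
  by rewrite lee_fin sumr_ge0// => j _; rewrite mulr_ge0// ltW.
have mg n : measurable_fun setT (g n : borel T -> \bar R).
  apply/measurable_EFinP; apply: measurable_sum => j; apply: measurable_funM => //.
  rewrite (_ : (fun _ => _) = \1_[set x : borel T | ((j.+1%:R * n.+1%:R^-1)%:E < f x)%E]).
    exact: measurable_indic.
  apply/funext => x; rewrite indicE; congr (nat_of_bool _)%:R.
  by apply/idP/idP; rewrite inE.
have gm n : (\int[mu]_x g n x <= m)%E.
  have /choice[l lP] : forall j : nat, exists l : \bar R,
      P k [set x | ((j.+1%:R * n.+1%:R^-1)%:E < f x)%E] @[k --> U] --> l /\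
      (mu [set x | ((j.+1%:R * n.+1%:R^-1)%:E < f x)%E] <= l)%E.
    by move=> j; have [l] := muP _ (oS (j.+1%:R * n.+1%:R^-1)); exists l.
  have cvgl : (\int[P k]_x g n x)%E @[k --> U] -->
      (\sum_(j < n.+1 * n.+1) n.+1%:R^-1%:E * l j)%E.
    under eq_fun do rewrite integral_staircase//.
    apply: cvg_nnesum => j _.
      by apply: nearW => k; rewrite mule_ge0// lee_fin ltW.
    by apply: cvgeZl => //; have [] := lP j.
  apply: (@le_trans _ _ (\sum_(j < n.+1 * n.+1) n.+1%:R^-1%:E * l j)%E).
    rewrite integral_staircase//; apply: lee_sum => j _.
    by rewrite lee_pmul2l//; have [] := lP j.
  apply: (lee_cvg_to cvgl fm); apply: nearW => k.
  by apply: ge0_le_integral => // x _; exact: staircase_le.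
(* The meshes are not nested, so [g n] need not increase with [n]; Fatou's lemma replaces monotone
   convergence. *)
rewrite (_ : (fun x => f x) = (fun x => limn_einf (g^~ x))); last first.
  by apply/funext => x; have [-> _] := cvg_limn_einf_sup (staircase_cvg (f0 x)).
apply: (le_trans (fatou mu measurableT mg _)) => //.
rewrite limn_einf_lim; apply: lime_le; first exact: is_cvg_einfs.
apply: nearW => n; apply: (le_trans _ (gm n)).
by apply: ereal_inf_lbound; exists n => /=.
Qed.

(** * Equality of measures from an inequality on open sets *)

(* In a compact Hausdorff set [D], an open set is a countable union of closures
   of basic open sets, hence an F_sigma; on closed sets the inequality between
   the two measures is reversed. *)
Lemma open_le_compact (R : realType) (T : ptopologicalType)
    (al be : probability (borel T) R) (V D : set T) :
  hausdorff_space T -> @second_countable T ->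
  (forall O : set T, open O -> al O <= be O)%E ->
  open V -> compact D -> (be (V `&` D) <= al (V `&` D))%E.
Proof.
move=> hT [B cB [Bopen Bbase]] albe oV cD.
have mO (O : set T) : open O -> measurable (O : set (borel T)).
  exact: sub_sigma_algebra.
have mC (F : set T) : closed F -> measurable (F : set (borel T)).
  by move=> cF; rewrite -[F]setCK; apply: measurableC; apply: mO; exact: closed_openC.
have beal (F : set T) : closed F -> (be F <= al F)%E.
  move=> cF; rewrite -[F]setCK; have oF := closed_openC cF.
  rewrite (probability_setC al (mO _ oF)) (probability_setC be (mO _ oF)).
  by apply: leeB => //; exact: albe.
have /countable_injP[i inji] := cB.
(* Enumerates the base through the injection [i]; an index that is not attained gets [set0]. *)
pose b n : set T := xget set0 [set W | B W /\ i W = n].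
have bi W : B W -> b (i W) = W.
  move=> BW; rewrite /b; case: xgetP => [W' _ [BW' iWW']|/(_ W)]; last by case.
  by apply: inji; rewrite ?inE.
pose F n : set T :=
  if `[< closure (b n) `&` D `<=` V >] then closure (b n) `&` D else set0.
have clF n : closed (F n).
  rewrite /F; case: asboolP => _; last exact: closed0.
  by apply: closedI; [exact: closed_closure|exact: compact_closed].
have UF : \bigcup_n F n = V `&` D.
  apply/seteqP; split => [x [n _]|x [Vx Dx]].
    by rewrite /F; case: asboolP => // sV xbD; split; [exact: sV|case: xbD].
  have [U [oU Ux] UDV] := compact_separate_closure hT cD oV Vx.
  have [W [BW Wx] WU] := Bbase x U (open_nbhs_nbhs (conj oU Ux)).
  exists (i W) => //; rewrite /F bi//; case: asboolP => [_|[]].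
    by split => //; exact: subset_closure.
  by move=> y [clWy Dy]; apply: UDV; split => //; exact: closureS clWy.
pose G n : set T := \big[setU/set0]_(j < n.+1) F j.
have clG n : closed (G n) by exact: closed_bigsetU.
have UG : \bigcup_n G n = V `&` D by rewrite bigcup_bigsetU_bigcup.
have mVD : measurable (\bigcup_n G n : set (borel T)).
  by apply: bigcupT_measurable => n; exact: mC.
have ndG : nondecreasing_seq G.
  by move=> m n mn; apply/subsetPset; exact: subset_bigsetU.
have cvgG (nu : probability (borel T) R) :
    nu (G n) @[n --> \oo] --> nu (V `&` D).
  by rewrite -UG; apply: nondecreasing_cvg_mu => // n; exact: mC.
by apply: (lee_cvg_to (cvgG be) (cvgG al)); apply: nearW => n; exact: beal.
Qed.

(** For open [O], [be O <= be (O & D) + be (~ D) <= al O + e] by [open_le_compact] and tightness.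
    Agreement on open sets, a generating class stable under intersection, extends to Borel sets. *)
Lemma open_le_tight_eq (R : realType) (T : ptopologicalType)
    (al be : probability (borel T) R) :
  hausdorff_space T -> @second_countable T ->
  (forall O : set T, open O -> al O <= be O)%E ->
  (forall e : R, 0 < e -> exists2 D : set T, compact D & ((1 - e)%:E <= be D)%E) ->
  eq_on_borel al be.
Proof.
move=> hT sT albe tight.
have mO (O : set T) : open O -> measurable (O : set (borel T)).
  exact: sub_sigma_algebra.
have opE (O : set T) : open O -> al O = be O.
  move=> oO; apply/eqP; rewrite eq_le albe//=; apply/lee_addgt0Pr => e e0.
  have [D cD beD] := tight e e0; have mD := compact_borel hT cD.
  rewrite (measureDI be (mO _ oO) mD) addeC; apply: leeD.
    apply: (le_trans (open_le_compact hT sT albe oO cD)).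
    rewrite le_measure ?inE//; last exact: mO.
    by apply: measurableI => //; exact: mO.
  apply: (@le_trans _ _ (be (~` D))).
    apply: le_measure => [||x []//]; rewrite inE.
      by apply: measurableD => //; exact: mO.
    exact: measurableC.
  rewrite probability_setC//; have fD : be D \is a fin_num by rewrite fin_num_measure.
  by move: beD; rewrite -(fineK fD) -EFinB !lee_fin; lra.
move=> A mA; apply: (@measure_unique _ R (borel T) (@open T) (fun=> setT) _ _ _ _ al be)
  => //.
- by move=> ? ? ? ?; exact: openI.
- by move=> _; exact: openT.
- by rewrite bigcup_const.
- by move=> _; rewrite (le_lt_trans (probability_le1 al measurableT))// ltry.
Qed.

Lemma continuous_borel_measurable (X Y : ptopologicalType) (f : X -> Y) :
  continuous f -> measurable_fun setT (f : borel X -> borel Y).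
Proof.
move=> cf; apply: (@measurability _ _ (borel X) (borel Y) setT f open) => //.
move=> _ [W oW <-]; rewrite setTI; apply: sub_sigma_algebra.
by apply: open_comp => // x _; exact: cf.
Qed.

(** * Topology of the spaces with an added point *)

Lemma adjoin_point_hausdorff (X : topologicalType) :
  hausdorff_space X -> hausdorff_space (adjoin_point X).
Proof.
have some_preimage (A : set X) : Some @^-1` (Some @` A) = A.
  by apply/seteqP; split => [x [y Ay [<-]]|x Ax]//; exists x.
have oS (A : set X) : open A -> open (Some @` A : set (adjoin_point X)).
  by move=> oA; rewrite /open/= /adjoin_open/= some_preimage.
have oN : open ([set None] : set (adjoin_point X)).
  rewrite /open/= /adjoin_open/= (_ : _ @^-1` _ = set0); first exact: open0.
  by apply/seteqP; split.
rewrite !open_hausdorff => hX [x|] [y|] xy //.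
- have [[A B] [xA yB] [oA oB AB0]] := hX x y xy.
  exists (Some @` A, Some @` B); rewrite /= ?inE.
    by split; [exists x|exists y] => //; apply: set_mem.
  split; [exact: oS|exact: oS|].
  apply/seteqP; split => // z [[s As <-] [t Bt [ts]]].
  by have : set0 s by rewrite -(eqP AB0); split => //=; rewrite -ts.
- exists (Some @` setT, [set None]); rewrite /= ?inE.
    by split => //; exists x.
  split => //; first by apply: oS; exact: openT.
  by apply/seteqP; split => // z [[s _ <-]].
- exists ([set None], Some @` setT); rewrite /= ?inE.
    by split => //; exists y.
  split => //; first by apply: oS; exact: openT.
  by apply/seteqP; split => // z [-> []].
Qed.

Lemma hat_hausdorff (b : bool) (X : ptopologicalType) :
  hausdorff_space X -> hausdorff_space (hat b X).
Proof. by case: b => //; exact: adjoin_point_hausdorff. Qed.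

Lemma nbhs_visible (b : bool) (X : ptopologicalType) (x : hat b X) (a : X)
    (V : set X) : visible x = Some a -> nbhs a V ->
  nbhs x [set y : hat b X | exists2 a', visible y = Some a' & V a'].
Proof.
case: b x => /= x; last first.
  by move=> [->]; apply: filterS => y Vy; exists y.
move=> ->; rewrite !nbhsE => -[B [oB Ba] BV]; exists (Some @` B).
  split; last by exists a.
  rewrite /open/= /adjoin_open/= (_ : _ @^-1` _ = B)//.
  by apply/seteqP; split => [z [y Ay [<-]]|z Bz]//; exists z.
by move=> _ [y By <-]; exists y => //; exact: BV.
Qed.

(** The added point being isolated, activity of an index is locally constant; this freezes the
    active indices in [path_cost_lsc]. *)
Lemma nbhs_isSome_visible (b : bool) (X : ptopologicalType) (x : hat b X) :
  nbhs x [set y : hat b X | isSome (visible y) = isSome (visible x)].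
Proof.
case: b x => /= x; last exact: filterE.
apply: open_nbhs_nbhs; split => //; rewrite /open/= /adjoin_open/=.
case: x => [x|]/=.
- by rewrite (_ : _ @^-1` _ = setT); [exact: openT|apply/seteqP; split].
- by rewrite (_ : _ @^-1` _ = set0); [exact: open0|apply/seteqP; split].
Qed.

(** * Lower semicontinuity of the path cost *)

Lemma lte_add_split (R : realType) (a : R) (x y : \bar R) :
  (0 <= x)%E -> (0 <= y)%E -> (a%:E < x + y)%E -> exists b b' : R,
    [/\ (b%:E < x)%E, (b'%:E < y)%E & a <= b + b'].
Proof.
case: x => [x| |]//; case: y => [y| |]// _ _.
(* The excess [x + y - a] is shared equally; when exactly one term is infinite, the finite one keeps
   a margin of 1. *)
- rewrite lte_fin => axy; exists (x - (x + y - a) / 2), (y - (x + y - a) / 2).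
  by rewrite !lte_fin; split; lra.
- by move=> _; exists (x - 1), (a - x + 1); rewrite lte_fin ltry; split => //; lra.
- by move=> _; exists (a - y + 1), (y - 1); rewrite lte_fin ltry; split => //; lra.
- by move=> _; exists a, 0; rewrite !ltry; split => //; lra.
Qed.

Lemma lower_semicontinuousD (R : realType) (X : topologicalType)
    (f g : X -> \bar R) :
  (forall x, 0 <= f x)%E -> (forall x, 0 <= g x)%E ->
  lower_semicontinuous f -> lower_semicontinuous g ->
  lower_semicontinuous (fun x => f x + g x)%E.
Proof.
move=> f0 g0 lf lg x a /(lte_add_split (f0 x) (g0 x))[b [b' [bf bg ab]]].
have [V xV Vf] := lf x b bf; have [W xW Wg] := lg x b' bg.
exists (V `&` W); first exact: filterI.
move=> y [/Vf bfy /Wg bgy]; apply: (@le_lt_trans _ _ (b%:E + b'%:E)%E).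
  by rewrite -EFinD lee_fin.
exact: lteD.
Qed.

Section path_cost_semicontinuity.
Local Open Scope ereal_scope.
Context {R : realType} {K : nat} {M : 'I_K.+1 -> ptopologicalType}.
Variable c : forall i j : 'I_K.+1, M i -> M j -> \bar R.
Hypothesis c_ge0 : forall i j : 'I_K.+1, (i < j)%N ->
  forall (x : M i) (y : M j), 0 <= c x y.
Hypothesis c_lsc : forall i j : 'I_K.+1, (i < j)%N ->
  lower_semicontinuous (fun z : M i * M j => c z.1 z.2).
Implicit Types (w : Omega (M := M)) (s : seq 'I_K.+1).

Lemma Omega_proj_continuous k : continuous (fun w => w k).
Proof. exact: (@proj_continuous 'I_K.+1 (fun k => hat_at (M := M) k) k). Qed.

Lemma Omega_hausdorff : (forall k, hausdorff_space (M k)) ->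
  hausdorff_space (Omega (M := M)).
Proof.
by move=> hM; apply: hausdorff_product => k; exact: hat_hausdorff.
Qed.

(* The junk value [0] keeps [leg i j] lower semicontinuous on all of Omega, the
   added points being isolated. *)
Definition leg (i j : 'I_K.+1) w : \bar R :=
  if visible (w i) is Some x then
    if visible (w j) is Some y then c x y else 0
  else 0.

(** Freezing the index list [s] makes the cost a fixed sum of legs, whereas the list in [path_cost]
    varies with [w]. *)
Fixpoint leg_sum s w : \bar R :=
  match s with
  | i :: (j :: _) as s' => leg i j w + leg_sum s' w
  | _ => 0
  end.

Let leg_ge0 (i j : 'I_K.+1) w : (i < j)%N -> 0 <= leg i j w.
Proof.
by move=> ij; rewrite /leg; case: visible => // x; case: visible => // y; exact: c_ge0.
Qed.

Let leg_lsc (i j : 'I_K.+1) : (i < j)%N -> lower_semicontinuous (leg i j).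
Proof.
move=> ij w a; rewrite {1}/leg.
(* Covers the case of an inactive endpoint at [w], where the leg is 0. *)
have neg : a%:E < 0 -> exists2 V, nbhs w V & forall w', V w' -> a%:E < leg i j w'.
  move=> a0; exists setT => [|w' _]; first exact: filterT.
  exact: lt_le_trans (leg_ge0 w' ij).
case wi : (visible (w i)) => [x|//]; case wj : (visible (w j)) => [y|//] acxy.
have [V [[A B]/= [xA yB] ABV] aV] := @c_lsc _ _ ij (x, y) a acxy.
have nA : nbhs w [set w' : Omega | exists2 x', visible (w' i) = Some x' & A x'].
  exact: (Omega_proj_continuous (nbhs_visible wi xA)).
have nB : nbhs w [set w' : Omega | exists2 y', visible (w' j) = Some y' & B y'].
  exact: (Omega_proj_continuous (nbhs_visible wj yB)).
apply: (ex_intro2 _ _ _ (filterI nA nB)).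
move=> w' [[x' + Ax'] [y' + By']] => /= w'i w'j.
by rewrite /leg w'i w'j; apply: (aV (x', y')); exact: ABV.
Qed.

Let leg_sum_ge0 s w : sorted (fun i j : 'I_K.+1 => i < j)%N s -> 0 <= leg_sum s w.
Proof.
elim: s => // i [|j s]//= IH /andP[ij js].
by rewrite adde_ge0 ?leg_ge0//; exact: IH.
Qed.

Let leg_sum_lsc s : sorted (fun i j : 'I_K.+1 => i < j)%N s ->
  lower_semicontinuous (leg_sum s).
Proof.
elim: s => [_ w a a0|i [|j s] IH].
- by exists setT => //; exact: filterT.
- by move=> _ w a a0; exists setT => //; exact: filterT.
- move=> /= /andP[ij js]; apply: lower_semicontinuousD.
  + by move=> w; exact: leg_ge0.
  + by move=> w; exact: (@leg_sum_ge0 (j :: s)).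
  + exact: leg_lsc.
  + exact: IH.
Qed.

Definition active_indices w : seq 'I_K.+1 :=
  [seq k <- enum 'I_K.+1 | isSome (visible (w k))].

Lemma active_indices_sorted w :
  sorted (fun i j : 'I_K.+1 => i < j)%N (active_indices w).
Proof.
apply: sorted_filter; first by move=> i j k; exact: ltn_trans.
by have := iota_ltn_sorted 0 K.+1; rewrite -val_enum_ord sorted_map.
Qed.

Lemma path_cost_leg_sum w : path_cost c w = leg_sum (active_indices w) w.
Proof.
rewrite /path_cost /active_points /active_indices.
set f := fun k => omap _ _; set vis := fun k => isSome _.
(* Once inactive indices are dropped, the induction runs over a list whose entries are all
   active. *)
have -> s : pmap f s = pmap f [seq k <- s | vis k].
  elim: s => //= k s ->; case vk : (vis k) => //=.
  by move: vk; rewrite /vis /f; case: visible.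
have visP k : vis k -> exists x, visible (w k) = Some x.
  by rewrite /vis; case: visible => // x; exists x.
have : all vis [seq k <- enum 'I_K.+1 | vis k] by exact: filter_all.
elim: [seq _ <- _ | _] => // i [|j s] IH /= /andP[vi].
  by have [x wi] := visP _ vi; rewrite /f wi.
move=> /[dup] /IH/= <- /andP[vj _].
have [x wi] := visP _ vi; have [y wj] := visP _ vj.
by rewrite /f wi wj /= /leg wi wj.
Qed.

Lemma path_cost_ge0 w : 0 <= path_cost c w.
Proof. by rewrite path_cost_leg_sum leg_sum_ge0// active_indices_sorted. Qed.

(** Finitely many coordinates decide the active indices, so near [w] the path cost coincides with
    the [leg_sum] of the list at [w]. *)
Lemma path_cost_lsc : lower_semicontinuous (path_cost c).
Proof.
move=> w a; rewrite path_cost_leg_sum => /(leg_sum_lsc (active_indices_sorted w)).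
move=> [V wV aV].
have nW : nbhs w [set w' : Omega | forall k,
    isSome (visible (w' k)) = isSome (visible (w k))].
  apply: (@filter_forall _ 'I_K.+1 (fun k w' =>
    isSome (visible (w' k)) = isSome (visible (w k))) (nbhs w)) => k.
  exact: (Omega_proj_continuous (nbhs_isSome_visible (w k))).
apply: (ex_intro2 _ _ _ (filterI wV nW)).
move=> w' [Vw' ww']; rewrite path_cost_leg_sum.
by rewrite (_ : active_indices w' = active_indices w) ?aV//; apply: eq_filter.
Qed.

End path_cost_semicontinuity.

(** * Tightness, marginals and the minimizer *)

Lemma compact_sublevel_tight (R : realType) (T : ptopologicalType)
    (P : nat -> probability (borel T) R) (Phi : borel T -> \bar R) :
  hausdorff_space T -> measurable_fun setT Phi -> (forall x, 0 <= Phi x)%E ->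
  (forall r : R, 0 < r -> compact ([set x | (Phi x <= r%:E)%E] : set T)) ->
  (ereal_sup (range (fun n => \int[P n]_x Phi x)) < +oo)%E ->
  forall e : R, 0 < e -> exists2 C : set T, compact C &
    forall n, ((1 - e)%:E <= P n C)%E.
Proof.
move=> hT mPhi Phi0 cPhi supPhi e e0.
have intle n : (\int[P n]_x Phi x <= ereal_sup (range (fun n => \int[P n]_x Phi x)))%E.
  by apply: ereal_sup_ubound; exists n.
have int0 n : (0 <= \int[P n]_x Phi x)%E by exact: integral_ge0.
move: supPhi intle; case: (ereal_sup _) => [s _ intle|//|_ intle]; last first.
  by have := le_trans (int0 0%N) (intle 0%N).
have s0 : 0 <= s by rewrite -lee_fin (le_trans (int0 0%N)).
(* Markov's inequality bounds the mass off [C] by [s / r <= e]; the added 1 keeps [r] positive when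
   [s = 0]. *)
pose r := s / e + 1; have r0 : 0 < r by rewrite ltr_wpDl// divr_ge0// ltW.
have cC := cPhi r r0; exists [set x | (Phi x <= r%:E)%E] => // n.
set C : set (borel T) := [set x | _]; have mC : measurable C by exact: compact_borel.
have PC : (r%:E * P n (~` C) <= s%:E)%E.
  apply: le_trans (intle n).
  rewrite [leRHS](_ : _ = \int[P n]_x `|Phi x|)%E; last first.
    by apply: eq_integral => x _; rewrite gee0_abs.
  apply: le_trans (le_integral_abse (P n) measurableT mPhi r0).
  rewrite lee_pmul2l//; apply: le_measure.
  - by rewrite inE; exact: measurableC.
  - rewrite inE; apply: emeasurable_fun_c_infty => //.
    exact: measurableT_comp.
  - move=> x /= /negP; rewrite -ltNge => rPhi; split => //.
    by rewrite /= gee0_abs// ltW.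
have fC : P n C \is a fin_num by rewrite fin_num_measure.
move: PC; rewrite probability_setC// -(fineK fC) -EFinB -EFinM !lee_fin => PC.
suff : 1 - fine (P n C) <= e by lra.
rewrite -(ler_pM2l r0); apply: (le_trans PC).
by rewrite /r mulrDl divfK ?gt_eqF// mul1r lerDl ltW.
Qed.

(** Preimages of open sets are open and have constant mass under [P n], so the image of [mu] is at
    most [nu] on open sets. Images of compact sets make [nu] tight, and [open_le_tight_eq]
    concludes. *)
Lemma open_limit_marginal (R : realType) (X Y : ptopologicalType) (f : X -> Y)
    (U : set_system nat) (P : nat -> probability (borel X) R)
    (mu : probability (borel X) R) (nu : probability (borel Y) R) :
  ProperFilter U -> hausdorff_space X -> hausdorff_space Y -> @second_countable Y ->
  continuous f -> open_limit U P mu ->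
  (forall e : R, 0 < e -> exists2 C : set X, compact C &
    forall n, ((1 - e)%:E <= P n C)%E) ->
  (forall n, eq_on_borel (pushforward (P n) (f : borel X -> borel Y)) nu) ->
  eq_on_borel (pushforward mu (f : borel X -> borel Y)) nu.
Proof.
move=> PU hX hY sY cf muP tight Pnu.
pose fM : {mfun borel X >-> borel Y} :=
  mfun_Sub (mem_set (continuous_borel_measurable cf)).
have mO (O : set Y) : open O -> measurable (O : set (borel Y)).
  exact: sub_sigma_algebra.
apply: (@open_le_tight_eq _ _ (distribution mu fM) nu) => // [V oV|e e0].
- have [l Pl mul] := muP _ (open_comp (fun x _ => cf x) oV).
  suff -> : nu V = l by exact: mul.
  apply/esym; have /cvg_unique := Pl; apply => //.
  rewrite (_ : (fun n => _) = cst (nu V)); first exact: cvg_cst.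
  by apply/funext => n; rewrite -(Pnu n)//; exact: mO.
- have [C cC PC] := tight e e0; have cfC : compact (f @` C).
    apply: continuous_compact => //; exact: continuous_subspaceT.
  exists (f @` C) => //; have mfC := compact_borel hY cfC.
  rewrite -(Pnu 0%N)//; apply: (le_trans (PC 0%N)); apply: le_measure.
  + by rewrite inE; exact: compact_borel.
  + rewrite inE -[X in measurable X]setTI.
    exact: (continuous_borel_measurable cf).
  + by move=> x Cx; exists x.
Qed.

Theorem theorem4p1 (R : realType) (K : nat) (hK : (1 <= K)%N)
  (M : 'I_K.+1 -> ptopologicalType) (dim : 'I_K.+1 -> nat)
  (g : forall k : 'I_K.+1, riemannian R (dim k) (M k))
  (g_complete : forall k : 'I_K.+1, metrically_complete (g k))
  (g0_boundaryless : boundaryless (g ord0))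
  (gK_boundaryless : boundaryless (g ord_max))
  (c : forall i j : 'I_K.+1, M i -> M j -> \bar R)
  (c_ge0 : forall i j : 'I_K.+1, (i < j)%N ->
     forall (x : M i) (y : M j), (0 <= c i j x y)%E)
  (c_lsc : forall i j : 'I_K.+1, (i < j)%N ->
     lower_semicontinuous (fun z : M i * M j => c i j z.1 z.2))
  (mu0 : probability (borel (hat_at (M := M) ord0)) R)
  (muK : probability (borel (hat_at (M := M) ord_max)) R) :
  optimal_value c mu0 muK \is a fin_num ->
  coercive c mu0 muK ->
  exists (mu : forall k : 'I_K.+1, probability (borel (hat_at (M := M) k)) R)
         (pi : probability (borel (Omega (M := M))) R),
    feasible mu0 muK mu pi /\ cost c pi = optimal_value c mu0 muK.
Proof.
move=> _ [Phi [mPhi Phi0 cPhi [P [[P0 PK Pcost] supPhi]]]].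
have hM k : hausdorff_space (M k) by exact: manifold_hausdorff (g k).
have hO := Omega_hausdorff hM.
have hH k : hausdorff_space (hat_at (M := M) k) by exact: hat_hausdorff.
(* At the two end indices no point is added, so the manifold's own countable base serves. *)
have sH (k : 'I_K.+1) : (0 < k < K)%N = false -> @second_countable (hat_at (M := M) k).
  rewrite /hat_at => ->; exact: manifold_second_countable (g k).
have tight := compact_sublevel_tight hO mPhi Phi0 cPhi supPhi.
have [U [UU ooU]] := ultraFilterLemma (eventually_filter).
have [pi piP] := open_limit_exists hO UU tight.
have marg k (nu : probability (borel (hat_at k)) R) : (0 < k < K)%N = false ->
    (forall n, marginal (P n) nu) -> marginal pi nu.
  move=> kK Pnu.
  apply: (@open_limit_marginal _ _ _ (fun w : Omega (M := M) => w k) U P) => //.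
  - exact: sH.
  - exact: Omega_proj_continuous.
pose TM k : {mfun borel (Omega (M := M)) >-> borel (hat_at (M := M) k)} :=
  mfun_Sub (mem_set (continuous_borel_measurable (@Omega_proj_continuous _ M k))).
(* The intermediate marginals are free, so they are read off from [pi]. *)
pose mu k : probability (borel (hat_at k)) R := distribution pi (TM k).
have feas : feasible mu0 muK mu pi.
  split; last by [].
  - exact: (marg ord0 mu0).
  - by apply: (marg ord_max muK) => //=; rewrite ltnn andbF.
exists mu, pi; split => //; apply/eqP; rewrite eq_le; apply/andP; split.
- apply: (open_limit_integral_le _ piP (path_cost_lsc c_ge0 c_lsc)).
    exact: path_cost_ge0.
  (* [U] refines the cofinite filter, so the costs also tend to the optimal value along [U]. *)
  apply: cvg_trans Pcost; exact: cvg_app.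
- by apply: ereal_inf_lbound; exists mu, pi.
Qed.
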